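(* Let $n\in\mathbb{N}$ and let $1\le p,p_1,\ldots,p_n<+\infty$ be such that $\frac1p\le\frac1{p_1}+\cdots+\frac1{p_n}$. Then $$\mathcal{L}_{\ell_{p_1}\langle\,\cdot\,\rangle,\ldots,\ell_{p_n}\langle\,\cdot\,\rangle;\ell_p\langle\,\cdot\,\rangle}\stackrel{1}{=}\mathcal{L}^n,$$ that is, for all Banach spaces $E_1,\ldots,E_n,F$ and every $A\in\mathcal{L}(E_1,\ldots,E_n;F)$, one has $(A(x_j^1,\ldots,x_j^n))_{j=1}^\infty\in\ell_p\langle F\rangle$ whenever $(x_j^m)_{j=1}^\infty\in\ell_{p_m}\langle E_m\rangle$, $m=1,\ldots,n$, and the induced $n$-linear operator $\widehat A\colon\ell_{p_1}\langle E_1\rangle\times\cdots\times\ell_{p_n}\langle E_n\rangle\to\ell_p\langle F\rangle$, $\widehat A((x_j^1)_j,\ldots,(x_j^n)_j)=(A(x_j^1,\ldots,x_j^n))_j$, satisfies $\|\widehat A\|=\|A\|$. In particular, the sequence class $\ell_p\langle\,\cdot\,\rangle$ is multilinearly stable for every $1\le p<+\infty$.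
   Context: All Banach spaces are over a fixed field $\mathbb{K}=\mathbb{R}$ or $\mathbb{C}$. $\mathcal{L}(E_1,\ldots,E_n;F)$ is the Banach space of continuous $n$-linear operators $E_1\times\cdots\times E_n\to F$ with the usual sup norm; $\mathcal{L}^n$ is the class of all continuous $n$-linear operators between Banach spaces with this norm. For a Banach space $G$ and $1\le q<\infty$, $\ell_q^w(G)$ is the space of weakly $q$-summable $G$-valued sequences with norm $\|(x_j)_{j=1}^\infty\|_{w,q}=\sup_{\varphi\in B_{G'}}\|(\varphi(x_j))_{j=1}^\infty\|_q$; for $q=\infty$, $\ell_\infty^w(G)=\ell_\infty(G)$ with the sup norm. For $1\le p<\infty$ with $\frac1p+\frac1{p^*}=1$, the space of Cohen strongly $p$-summable sequences is $$\ell_p\langle E\rangle=\Big\{(x_j)_{j=1}^\infty\in E^{\mathbb{N}}:\|(x_j)_{j=1}^\infty\|_{\ell_p\langle E\rangle}:=\sup_{(\varphi_j)_{j=1}^\infty\in B_{\ell_{p^*}^w(E')}}\|(\varphi_j(x_j))_{j=1}^\infty\|_1<+\infty\Big\},$$ where $B_{\ell_{p^*}^w(E')}$ is the closed unit ball of $\ell_{p^*}^w(E')$ and $E'$ is the topological dual of $E$. The rule $E\mapsto\ell_p\langle E\rangle$ is a sequence class, i.e. it assigns to each $E$ a Banach space of $E$-valued sequences containing the finite sequences, contained in the bounded sequences with sup norm $\le\|\cdot\|_{\ell_p\langle E\rangle}$, and with canonical scalar unit sequences of norm one when $E=\mathbb{K}$. A sequence class $X$ is multilinearly stable if for every $n\in\mathbb{N}$,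 all Banach spaces $E_1,\ldots,E_n,F$ and every $A\in\mathcal{L}(E_1,\ldots,E_n;F)$, one has $(A(x_j^1,\ldots,x_j^n))_{j=1}^\infty\in X(F)$ whenever $(x_j^m)_{j=1}^\infty\in X(E_m)$, $m=1,\ldots,n$, and the induced operator $\widehat A\colon X(E_1)\times\cdots\times X(E_n)\to X(F)$ satisfies $\|\widehat A\|=\|A\|$. *)

(* Defs.v *)
From HB Require Import structures.
From mathcomp Require Import all_boot all_order all_algebra.
From mathcomp Require Import complex.
From mathcomp Require Import all_classical all_reals all_analysis.

Set Implicit Arguments.
Unset Strict Implicit.
Unset Printing Implicit Defensive.

Import Order.TTheory GRing.Theory Num.Theory.
Import numFieldNormedType.Exports.

Local Open Scope classical_set_scope.
Local Open Scope ring_scope.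

Variant scalar_kind := RealScalars | ComplexScalars.

Definition scalars (R : realType) (k : scalar_kind) : numFieldType :=
  match k with RealScalars => R | ComplexScalars => R[i] end.

(* Norms of normed modules over [scalars R k] take their values in
   [scalars R k]; [toR] and [ofR] identify these values with elements of [R]. *)
Definition toR (R : realType) (k : scalar_kind) : scalars R k -> R :=
  match k with RealScalars => fun x => x | ComplexScalars => @complex.Re R end.

Definition ofR (R : realType) (k : scalar_kind) : R -> scalars R k :=
  match k with RealScalars => fun x => x | ComplexScalars => fun x => x%:C%C end.

Arguments toR {R k}.
Arguments ofR {R k}.

Section scalars_theory.
Context (R : realType) (k : scalar_kind).
Local Notation K := (scalars R k).

Lemma ofR0 : ofR 0 = 0 :> K.
Proof. by rewrite /ofR; case: k. Qed.

Lemma ofR1 : ofR 1 = 1 :> K.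
Proof. by rewrite /ofR; case: k. Qed.

Lemma ofRD (a b : R) : ofR (a + b) = ofR a + ofR b :> K.
Proof. by rewrite /ofR; case: k => //=; rewrite rmorphD. Qed.

Lemma ofRM (a b : R) : ofR (a * b) = ofR a * ofR b :> K.
Proof. by rewrite /ofR; case: k => //=; rewrite rmorphM. Qed.

Lemma ofRK : cancel (@ofR R k) toR.
Proof. by rewrite /ofR /toR; case: k. Qed.

Lemma ler_ofR (a b : R) : (ofR a <= ofR b :> K) = (a <= b).
Proof. by rewrite /ofR; case: k => //=; rewrite lecR. Qed.

Lemma toRK (V : normedZmodType K) (x : V) : ofR (toR `|x|) = `|x|.
Proof.
have: 0 <= `|x| by [].
move: `|x| => /=; rewrite /ofR /toR; case: k => //= -[a b].
by rewrite lecE /= => /andP[/eqP -> _].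
Qed.
End scalars_theory.

Definition rnorm (R : realType) (k : scalar_kind)
  (V : normedZmodType (scalars R k)) (x : V) : R := toR `|x|.

Section rnorm_theory.
Context (R : realType) (k : scalar_kind).
Local Notation K := (scalars R k).

Lemma rnormK (V : normedZmodType K) (x : V) : ofR (rnorm x) = `|x|.
Proof. exact: toRK. Qed.

Lemma ler_rnorm (V W : normedZmodType K) (x : V) (y : W) :
  (rnorm x <= rnorm y) = (`|x| <= `|y|).
Proof. by rewrite -!rnormK ler_ofR. Qed.

Lemma rnorm_ge0 (V : normedZmodType K) (x : V) : 0 <= rnorm x.
Proof. by rewrite -(ler_ofR k) rnormK ofR0. Qed.

Lemma rnorm0 (V : normedZmodType K) : rnorm (0 : V) = 0.
Proof. by apply: (can_inj (@ofRK R k)); rewrite rnormK normr0 ofR0. Qed.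

Lemma rnorm0_eq0 (V : normedZmodType K) (x : V) : rnorm x = 0 -> x = 0.
Proof. by move=> x0; apply: normr0_eq0; rewrite -rnormK x0 ofR0. Qed.

Lemma rnormD (V : normedZmodType K) (x y : V) :
  rnorm (x + y) <= rnorm x + rnorm y.
Proof. by rewrite -(ler_ofR k) ofRD !rnormK ler_normD. Qed.

Lemma rnormZ (V : normedModType K) (a : K) (x : V) :
  rnorm (a *: x) = rnorm a * rnorm x.
Proof. by apply: (can_inj (@ofRK R k)); rewrite ofRM !rnormK normrZ. Qed.
End rnorm_theory.

Section dual.
Context (R : realType) (k : scalar_kind).
Local Notation K := (scalars R k).
Context (E : normedModType K).

Definition continuous_functional : {pred E -> K^o} :=
  [pred f : E -> K^o | `[< linear f /\ continuous f >]].

Record dual := Dual { dual_val :> E -> K^o ; _ : dual_val \in continuous_functional }.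

HB.instance Definition _ := [isSub for dual_val].
HB.instance Definition _ := [Choice of dual by <:].

Lemma continuous_functional_submod : submod_closed continuous_functional.
Proof.
split.
  apply/asboolP; split; first by move=> a x y /=; rewrite scaler0 addr0.
  by move=> x; apply: cvg_cst.
move=> a f g /asboolP[lf cf] /asboolP[lg cg]; apply/asboolP; split.
  move=> b x y; rewrite !fctE lf lg !scalerDr !scalerA (mulrC a).
  by rewrite addrACA.
move=> x; apply: (@cvgD _ K^o _ _ _ (fun y => a *: f y)); last exact: cg.
by apply: cvgZl_tmp; exact: cf.
Qed.

HB.instance Definition _ :=
  GRing.isSubmodClosed.Build _ _ continuous_functional continuous_functional_submod.
HB.instance Definition _ := [SubChoice_isSubLmodule of dual by <:].

Definition dual_norm (f : dual) : R :=
  sup [set rnorm (f x) | x in [set x : E | rnorm x <= 1]].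


Lemma dual_linear (f : dual) : linear f.
Proof. by have /asboolP[] := valP f. Qed.

Lemma dual_continuous (f : dual) : continuous f.
Proof. by have /asboolP[] := valP f. Qed.

HB.instance Definition _ (f : dual) :=
  GRing.isLinear.Build K E K^o _ f (dual_linear f).

Lemma dual_norm_has_sup (f : dual) :
  has_sup [set rnorm (f x) | x in [set x : E | rnorm x <= 1]].
Proof.
split; first by exists (rnorm (f 0)), 0 => //=; rewrite rnorm0.
have /linear_boundedP := continuous_linear_bounded 0 (@dual_continuous f 0).
move=> /pinfty_ex_gt0[M M0 fM].
exists (toR M) => _ [x /= x1 <-]; rewrite -(ler_ofR k) rnormK.
have -> : ofR (toR M) = M by rewrite -(gtr0_norm M0) toRK.
rewrite (le_trans (fM x))// ger_pMr// -rnormK.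
by rewrite -(@ofR1 R k) ler_ofR.
Qed.

Lemma dual_norm_ub (f : dual) (x : E) :
  rnorm x <= 1 -> rnorm (f x) <= dual_norm f.
Proof.
by move=> x1; apply: sup_upper_bound; [exact: dual_norm_has_sup|exists x].
Qed.

Lemma dual_norm_lub (f : dual) (c : R) :
  (forall x, rnorm x <= 1 -> rnorm (f x) <= c) -> dual_norm f <= c.
Proof.
move=> fc; apply: ge_sup; first by have [] := dual_norm_has_sup f.
by move=> _ [x /= x1 <-]; exact: fc.
Qed.

Lemma dual_norm_ge0 (f : dual) : 0 <= dual_norm f.
Proof.
rewrite (le_trans (rnorm_ge0 (f 0)))//.
by apply: dual_norm_ub; rewrite rnorm0.
Qed.

Lemma dual_normD (f g : dual) : dual_norm (f + g) <= dual_norm f + dual_norm g.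
Proof.
apply: dual_norm_lub => x x1; rewrite (le_trans (rnormD _ _))//.
by apply: lerD; exact: dual_norm_ub.
Qed.

Lemma dual_normZ_le (a : K) (f : dual) :
  dual_norm (a *: f) <= rnorm a * dual_norm f.
Proof.
apply: dual_norm_lub => x x1.
rewrite (_ : rnorm _ = rnorm a * rnorm (f x)); last exact: rnormZ.
by apply: ler_wpM2l; [exact: rnorm_ge0|exact: dual_norm_ub].
Qed.

Lemma dual_normZ (a : K) (f : dual) :
  dual_norm (a *: f) = rnorm a * dual_norm f.
Proof.
apply/eqP; rewrite eq_le dual_normZ_le/=.
have [->|a0] := eqVneq a 0; first by rewrite rnorm0 mul0r dual_norm_ge0.
have := dual_normZ_le a^-1 (a *: f); rewrite scalerA mulVf// scale1r.
have ra : rnorm a * rnorm a^-1 = 1.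
  rewrite -rnormZ /GRing.scale/= mulfV//.
  by apply: (can_inj (@ofRK R k)); rewrite rnormK normr1 ofR1.
move=> /(ler_wpM2l (rnorm_ge0 a)).
by rewrite mulrA ra mul1r.
Qed.

Lemma dual_norm0_eq0 (f : dual) : dual_norm f = 0 -> f = 0.
Proof.
move=> f0; apply: val_inj; apply/funext => x /=.
have [->|x0] := eqVneq x 0; first by rewrite linear0.
have : rnorm (f (`|x|^-1 *: x)) <= 0.
  rewrite -f0; apply: dual_norm_ub; rewrite -(ler_ofR k) rnormK normrZ.
  rewrite normfV normr_id mulVf ?normr_eq0//.
  by rewrite ofR1.
rewrite linearZ/= rnormZ => fx0.
have {fx0} : rnorm `|x|^-1 * rnorm (f x) = 0.
  by apply/eqP; rewrite eq_le fx0 mulr_ge0 ?rnorm_ge0.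
move=> /eqP; rewrite mulf_eq0 => /orP[|] /eqP/rnorm0_eq0 //.
by move=> /eqP; rewrite invr_eq0 normr_eq0 (negbTE x0).
Qed.

Let dual_normr (f : dual) : K := ofR (dual_norm f).

Let dual_normrD f g : dual_normr (f + g) <= dual_normr f + dual_normr g.
Proof. by rewrite /dual_normr -ofRD ler_ofR dual_normD. Qed.

Let dual_normrZ a f : dual_normr (a *: f) = `|a| * dual_normr f.
Proof. by rewrite /dual_normr dual_normZ ofRM rnormK. Qed.

Let dual_normr0_eq0 f : dual_normr f = 0 -> f = 0.
Proof.
move=> f0; apply: dual_norm0_eq0; apply: (can_inj (@ofRK R k)).
by rewrite -/(dual_normr f) f0 ofR0.
Qed.

HB.instance Definition _ :=
  Lmodule_isNormed.Build K dual dual_normrD dual_normrZ dual_normr0_eq0.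

Lemma dual_rnormE (f : dual) : rnorm f = dual_norm f.
Proof. exact: ofRK. Qed.

End dual.

Section sequence_spaces.
Context (R : realType) (k : scalar_kind).
Local Notation K := (scalars R k).

(* The norm of l_q^w(G) as an extended real: a sequence is in the space when
   the value is finite. *)
Definition weak_norm (q : \bar R) (G : normedModType K) (x : nat -> G) : \bar R :=
  match q with
  | +oo%E => ereal_sup (range (fun j => (rnorm (x j))%:E))
  | _ => ereal_sup [set Lnorm counting q (fun j => (rnorm (phi (x j)))%:E) |
                    phi in [set phi : dual G | rnorm phi <= 1]]
  end.

Definition cohen_norm (p : R) (E : normedModType K) (x : nat -> E) : \bar R :=
  ereal_sup [set Lnorm counting 1%:E (fun j => (rnorm (phi j (x j)))%:E) |
    phi in [set phi : nat -> dual E |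
            (weak_norm (hoelder_conjugate p%:E) phi <= 1)%E]].

(* The data of a sequence class E |-> X(E): the underlying set of X(E) and its
   norm, whose values outside X(E) are irrelevant.  The definitions below
   depend on this data only. *)
Record sequence_rule := SequenceRule {
  seq_space : forall E : completeNormedModType K, set (nat -> E) ;
  seq_norm : forall E : completeNormedModType K, (nat -> E) -> R
}.

Definition cohen (p : R) : sequence_rule := {|
  seq_space := fun E => [set x | (cohen_norm p x < +oo)%E] ;
  seq_norm := fun E x => fine (cohen_norm p x)
|}.

End sequence_spaces.

Arguments cohen {R} k p.

Section multilinear.
Context (R : realType) (k : scalar_kind) (n : nat).
Local Notation K := (scalars R k).
Context (E : 'I_n -> completeNormedModType K) (F : completeNormedModType K).

Definition multilinear (A : (forall i, E i) -> F) : Prop :=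
  forall (i : 'I_n) (x : forall i, E i), linear (fun y : E i => A (dfwith x i y)).

Definition continuous_multilinear (A : (forall i, E i) -> F) : Prop :=
  multilinear A /\ continuous (A : prod_topology E -> F).

Definition multilinear_norm (A : (forall i, E i) -> F) : \bar R :=
  ereal_sup [set (rnorm (A x))%:E | x in [set x | forall i, rnorm (x i) <= 1]].

Definition induced (A : (forall i, E i) -> F)
    (x : forall i, nat -> E i) : nat -> F :=
  fun j => A (fun i => x i j).

Definition induced_norm (X : 'I_n -> sequence_rule R k) (Y : sequence_rule R k)
    (A : (forall i, E i) -> F) : \bar R :=
  ereal_sup [set (seq_norm Y (induced A x))%:E |
    x in [set x | forall i, seq_space (X i) (x i) /\ seq_norm (X i) (x i) <= 1]].

End multilinear.

Section stability.
Context (R : realType) (k : scalar_kind).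
Local Notation K := (scalars R k).

(* The isometric equality of L_{X_1,...,X_n;Y} with the class of all
   continuous n-linear operators. *)
Definition all_multilinear_isometrically (n : nat)
    (X : 'I_n -> sequence_rule R k) (Y : sequence_rule R k) : Prop :=
  forall (E : 'I_n -> completeNormedModType K) (F : completeNormedModType K)
    (A : (forall i, E i) -> F), continuous_multilinear A ->
  (forall x : forall i, nat -> E i,
     (forall i, seq_space (X i) (x i)) -> seq_space Y (induced A x)) /\
  induced_norm X Y A = multilinear_norm A.

Definition multilinearly_stable (X : sequence_rule R k) : Prop :=
  forall n : nat, (0 < n)%N -> all_multilinear_isometrically (fun _ : 'I_n => X) X.

End stability.

(* Main.v *)
Require Import Defs.
From HB Require Import structures.
From mathcomp Require Import all_boot all_order all_algebra.
From mathcomp Require Import complex ring lra.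
From mathcomp Require Import all_classical all_reals all_analysis.

Set Implicit Arguments.
Unset Strict Implicit.
Unset Printing Implicit Defensive.

Import Order.TTheory GRing.Theory Num.Theory.
Import numFieldNormedType.Exports.

Local Open Scope classical_set_scope.
Local Open Scope ring_scope.

(** Fix [psi] in the unit ball of the weak l_(p') sequences of the dual of [F],
    where [1/p + 1/p' = 1].
    One has to bound [sum_j |psi_j (A (x^1_j, ..., x^n_j))|] by the norm of [A]
    times the product of the Cohen norms of the [x^m].

    Start with vectors [y_i] of the unit balls of the [E_i] and scalar sequences
    [a^i] of the unit balls of the l_(q_i). Hoelder's inequality for [n + 1]
    factors ([hoelder_prod_le1]), to which the hypothesis
    [1/p <= 1/q_1 + ... + 1/q_n] is tailored, gives
    [sum_j |a^1_j ... a^n_j psi_j (A (y_1, ..., y_n))| <= norm of A].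

    The vectors are now replaced by the sequences one coordinate at a time
    ([splice_sum_le]). When the coordinates before [m] hold sequences, the
    functionals [phi_j v = (product of the a^i_j, i > m) psi_j (A (..., v, ...))],
    with [v] in coordinate [m], satisfy
    [sum_j |a_j phi_j v| <= C] for all [v] and [a] of the unit balls of [E_m]
    and l_(q_m). This says that [phi] has weak norm at most [C] in l_(q_m'): in
    a dual space, weak summability only has to be tested on vectors of the
    predual ([weak_norm_dual_le1]). The definition of the Cohen norm of [x^m]
    then yields [sum_j |phi_j x^m_j| <= C * norm of x^m]
    ([cohen_norm_test]), which is the estimate for [m + 1].

    The converse inequality of norms is seen on sequences [(y_i, 0, 0, ...)]: the
    Cohen norm of a sequence dominates the norm of its first term, as some
    functional of norm at most one attains it ([norming_functional]). This
    consequence of the Hahn-Banach theorem is obtained from minimal sublinear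
    functionals, which Zorn's lemma provides and which are linear. *)

(** * Hoelder's inequality for several finite sequences *)

Section hoelder_finite.
Context (R : realType).

Lemma powR_le1 (a t : R) : 0 <= a -> a <= 1 -> 0 <= t -> a `^ t <= 1.
Proof.
move=> a0 a1 t0; have := ge0_ler_powR t0 a0 _ a1.
by rewrite powR1; apply; rewrite nnegrE ler01.
Qed.

Lemma powR_le_expR (x w : R) : 0 <= x -> 0 <= w -> x `^ w <= expR (w * (x - 1)).
Proof.
move=> x0 w0; rewrite mulrC expRM; apply: ge0_ler_powR => //.
- by rewrite nnegrE expR_ge0.
- by rewrite -{1}(subrKC 1 x) expR_ge1Dx.
Qed.

(** Divide the [a i] by their weighted mean [S], bound each factor by
    [powR_le_expR], and observe that the exponents then add up to 0. *)
Lemma weighted_AMGM (I : finType) (w a : I -> R) :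
  (forall i, 0 <= w i) -> (forall i, 0 <= a i) -> \sum_i w i = 1 ->
  \prod_i a i `^ w i <= \sum_i w i * a i.
Proof.
move=> w0 a0 w1; set S := \sum_i w i * a i.
have S0 : 0 <= S by apply: sumr_ge0 => i _; exact: mulr_ge0.
have [S_eq0|Sn0] := eqVneq S 0.
  have [i wi0] : exists i, w i != 0.
    apply/existsP; apply: contra_eqT w1; rewrite negb_exists => /forallP w_eq0.
    rewrite big1 ?(eq_sym 0) ?oner_neq0// => i _.
    by apply/eqP; rewrite -[_ == _]negbK.
  have ai0 : a i = 0.
    have /eqP : w i * a i = 0.
      have := psumr_eq0P (fun i _ => mulr_ge0 (w0 i) (a0 i)) S_eq0; exact.
    by rewrite mulf_eq0 (negbTE wi0) => /eqP.
  by rewrite (bigD1 i)//= ai0 powR0// mul0r.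
have Sgt0 : 0 < S by rewrite lt_def Sn0.
have prodS : \prod_i S `^ w i = S.
  transitivity (S `^ (\sum_i w i)); last by rewrite w1 powRr1.
  have SD x y : S `^ (x + y) = S `^ x * S `^ y by rewrite powRD// Sn0 implybT.
  by rewrite (big_morph _ SD (powRr0 S)).
have <- : (\prod_i (a i / S) `^ w i) * S = \prod_i a i `^ w i.
  rewrite -[X in _ * X = _]prodS -big_split/=; apply: eq_bigr => i _.
  by rewrite -powRM ?divr_ge0// divfK.
rewrite ger_pMl//.
have e1 : expR (\sum_i w i * (a i / S - 1)) = 1.
  under eq_bigr do rewrite mulrBr mulr1 mulrA.
  by rewrite big_split/= sumrN -mulr_suml divff// w1 subrr expR0.
rewrite -[leRHS]e1 expR_sum; apply: ler_prod => i _.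
by rewrite powR_ge0 powR_le_expR ?divr_ge0.
Qed.

(** Raising a number of [0, 1] to a smaller power increases it, so the weights
    may be shrunk until they sum to 1; then the arithmetic-geometric mean
    inequality is summed term by term. *)
Lemma hoelder_prod_le1 (I : finType) (N : nat) (w : I -> R) (a : I -> nat -> R) :
  (forall i, 0 <= w i) -> 1 <= \sum_i w i ->
  (forall i j, 0 <= a i j) -> (forall i, \sum_(j < N) a i j <= 1) ->
  \sum_(j < N) \prod_i a i j `^ w i <= 1.
Proof.
move=> w0 w1 a0 a1; set s := \sum_i w i in w1.
have s0 : 0 < s by exact: lt_le_trans w1.
have shrink i (j : 'I_N) : a i j `^ w i <= a i j `^ (w i / s).
  have [->|aij0] := eqVneq (a i j) 0.
    have [->|wi0] := eqVneq (w i) 0; first by rewrite mul0r.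
    by rewrite powR0// powR_ge0.
  apply: ger_powR; last by rewrite ler_pdivrMr// ler_peMr.
  rewrite lt_def aij0 a0/= (le_trans _ (a1 i))//.
  by rewrite (bigD1 j)//= lerDl sumr_ge0.
apply: (@le_trans _ _ (\sum_(j < N) \sum_i w i / s * a i j)).
  apply: ler_sum => j _.
  apply: (@le_trans _ _ (\prod_i a i j `^ (w i / s))).
    by apply: ler_prod => i _; rewrite powR_ge0 shrink.
  apply: weighted_AMGM => // [i|]; first by rewrite divr_ge0// ltW.
  by rewrite -mulr_suml divff// gt_eqF.
rewrite exchange_big/=.
apply: (@le_trans _ _ (\sum_i w i / s)); last by rewrite -mulr_suml divff// gt_eqF.
by apply: ler_sum => i _; rewrite -mulr_sumr ler_piMr// divr_ge0// ltW.
Qed.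

End hoelder_finite.

(** * The Hahn-Banach theorem for real and complex scalars *)

Section hahn_banach.
Context (R : realType) (k : scalar_kind).
Local Notation K := (scalars R k).

Section sublinear_functionals.
Context (V : lmodType K).

Definition sublinear (p : V -> R) : Prop :=
  (forall x y, p (x + y) <= p x + p y) /\
  (forall (t : R) x, 0 < t -> p (ofR t *: x) <= t * p x).

Lemma sublinear0 (p : V -> R) : sublinear p -> p 0 = 0.
Proof.
move=> [_ pZ]; have p2 := pZ 2 0 (ltr0Sn R 1); have ph := pZ 2^-1 0.
rewrite !scaler0 in p2 ph; move: ph; rewrite invr_gt0 ltr0Sn => /(_ isT).
by move: p2 => *; lra.
Qed.

Lemma sublinear_geN (p : V -> R) x : sublinear p -> - p (- x) <= p x.
Proof.
move=> sp; have := sp.1 x (- x); rewrite subrr (sublinear0 sp).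
by move=> pxN; rewrite -subr_ge0 opprK.
Qed.

Lemma sublinearZ (p : V -> R) t x : sublinear p -> 0 <= t ->
  p (ofR t *: x) = t * p x.
Proof.
move=> sp; rewrite le_eqVlt => /predU1P[<-|t0].
  by rewrite ofR0 scale0r mul0r sublinear0.
apply/eqP; rewrite eq_le sp.2//=.
have tV : 0 < t^-1 by rewrite invr_gt0.
have := sp.2 t^-1 (ofR t *: x) tV.
by rewrite scalerA -ofRM mulVf ?gt_eqF// ofR1 scale1r ler_pdivlMl.
Qed.

(** The largest sublinear functional below [q] which is at most [- q z] at
    [- z]; thus a minimal [q] has [q (- z) = - q z] for all [z]. *)
Definition push_along (q : V -> R) (z x : V) : R :=
  inf [set q (x + ofR t *: z) - t * q z | t in [set t | 0 <= t]].

Section push_along.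
Context (q : V -> R) (z : V) (sq : sublinear q).

Lemma push_along_lb x t : 0 <= t -> - q (- x) <= q (x + ofR t *: z) - t * q z.
Proof.
move=> t0; rewrite lerBrDr -sublinearZ// addrC lerBlDr.
by rewrite (le_trans _ (sq.1 _ _))// addrAC subrr add0r.
Qed.

Lemma push_along_ge x t : 0 <= t ->
  push_along q z x <= q (x + ofR t *: z) - t * q z.
Proof.
move=> t0; apply: ge_inf; last by exists t.
by exists (- q (- x)) => _ [s /= s0 <-]; exact: push_along_lb.
Qed.

Lemma le_push_along x c :
  (forall t, 0 <= t -> c <= q (x + ofR t *: z) - t * q z) ->
  c <= push_along q z x.
Proof.
move=> cq; apply: lb_le_inf; last by move=> _ [t /= t0 <-]; exact: cq.
by exists (q (x + ofR 0 *: z) - 0 * q z), 0 => /=.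
Qed.

Lemma push_along_le x : push_along q z x <= q x.
Proof.
have := push_along_ge x (lexx 0).
by rewrite ofR0 scale0r addr0 mul0r subr0.
Qed.

Lemma push_along_opp : push_along q z (- z) <= - q z.
Proof.
have := push_along_ge (- z) ler01.
by rewrite ofR1 scale1r addNr (sublinear0 sq) mul1r sub0r.
Qed.

Lemma sublinear_push_along : sublinear (push_along q z).
Proof.
split=> [x y|s x s0].
  rewrite -lerBlDr; apply: le_push_along => t t0.
  rewrite lerBlDr -lerBlDl; apply: le_push_along => u u0.
  rewrite lerBlDr; apply: (le_trans (push_along_ge _ (addr_ge0 t0 u0))).
  rewrite ofRD scalerDl (addrACA x).
  by have := sq.1 (x + ofR t *: z) (y + ofR u *: z); lra.
rewrite mulrC -ler_pdivrMr//; apply: le_push_along => t t0.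
rewrite ler_pdivrMr//; apply: (le_trans (push_along_ge _ (mulr_ge0 (ltW s0) t0))).
rewrite ofRM -scalerA -scalerDr sublinearZ ?(ltW s0)//.
by rewrite -mulrA -mulrBr mulrC.
Qed.

End push_along.

(** The infimum of a chain of sublinear functionals is sublinear, so minimal
    ones exist below [p]; by [push_along_opp] a minimal one is odd, and an odd
    sublinear functional is additive. *)
Lemma sublinear_ge_linear (p : V -> R) : sublinear p ->
  exists f : V -> R, [/\ forall x, f x <= p x,
    forall x y, f (x + y) = f x + f y &
    forall t x, f (ofR t *: x) = t * f x].
Proof.
move=> sp.
pose T := {q : V -> R | sublinear q /\ forall x, q x <= p x}.
pose below (q r : T) : bool := `[< forall x, sval r x <= sval q x >].
have lbT (q : T) x : - p (- x) <= sval q x.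
  case: q => q /= [sq qp]; apply: le_trans (sublinear_geN x sq).
  by rewrite lerN2.
have [|a b c /asboolP ab /asboolP bc|[a Pa] [b Pb] /asboolP/= ab /asboolP/= ba|A Atot|q qmin]
  := @Zorn T below.
- by move=> q; apply/asboolP => x.
- by apply/asboolP => x; exact: le_trans (bc x) (ab x).
- by apply: eq_exist; apply/funext => x; apply/le_anti; rewrite ab ba.
- have [[a0 Aa0]|A0] := pselect (exists a, A a); last first.
    have Pp : sublinear p /\ forall x, p x <= p x by split.
    by exists (exist _ p Pp) => s As; exfalso; apply: A0; exists s.
  pose m x := inf [set sval a x | a in A].
  have m_le a x : A a -> m x <= sval a x.
    move=> Aa; apply: ge_inf; last by exists a.
    by exists (- p (- x)) => _ [b _ <-].
  have le_m c x : (forall a, A a -> c <= sval a x) -> c <= m x.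
    move=> ca; apply: lb_le_inf; first by exists (sval a0 x), a0.
    by move=> _ [a Aa <-]; exact: ca.
  have sm : sublinear m.
    split=> [x y|t x t0].
      rewrite -lerBlDr; apply: (le_m _ _) => a Aa.
      rewrite lerBlDr -lerBlDl; apply: (le_m _ _) => b Ab.
      rewrite lerBlDr.
      have [/asboolP ba|/asboolP ab] := Atot a b Aa Ab.
        rewrite (le_trans (m_le b _ Ab))// (le_trans ((svalP b).1.1 _ _))//.
        by rewrite addrC lerD2l.
      rewrite (le_trans (m_le a _ Aa))// (le_trans ((svalP a).1.1 _ _))//.
      by rewrite addrC lerD2r.
    rewrite mulrC -ler_pdivrMr//; apply: (le_m _ _) => a Aa.
    rewrite ler_pdivrMr// mulrC (le_trans (m_le a _ Aa))//.
    exact: (svalP a).1.2.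
  have Pm : sublinear m /\ forall x, m x <= p x.
    split=> // x; rewrite (le_trans (m_le a0 x Aa0))//; exact: (svalP a0).2.
  by exists (exist _ m Pm) => a Aa; apply/asboolP => x; exact: m_le.
case: q qmin => q [sq qp] qmin.
have qN z : q (- z) = - q z.
  apply/eqP; rewrite eq_le; apply/andP; split; last first.
    by rewrite lerNl sublinear_geN.
  have Pq : sublinear (push_along q z) /\ forall x, push_along q z x <= p x.
    split; first exact: sublinear_push_along.
    by move=> x; rewrite (le_trans (push_along_le _ _ _)).
  have /(congr1 sval)/= e := qmin (exist _ _ Pq) (asboolT (push_along_le z sq)).
  by rewrite -[X in X (- z)]e push_along_opp.
exists q; split=> // [x y|t x].
  apply/eqP; rewrite eq_le sq.1/= -lerBrDr -qN.
  by rewrite -{1}(addrK y x) sq.1.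
have [t0|t0] := leP 0 t; first exact: sublinearZ.
have -> : ofR t *: x = - (ofR (- t) *: x).
  rewrite -scaleNr; congr (_ *: _); apply/eqP.
  by rewrite -addr_eq0 -ofRD subrr ofR0.
by rewrite qN sublinearZ ?oppr_ge0 ?ltW// mulNr opprK.
Qed.

End sublinear_functionals.
End hahn_banach.

(** Over the complex numbers, [f] is the real part of [x |-> f x - i f (i x)]. *)
Lemma linear_real_part (R : realType) (k : scalar_kind)
    (V : lmodType (scalars R k)) (f : V -> R) :
  (forall x y, f (x + y) = f x + f y) -> (forall t x, f (ofR t *: x) = t * f x) ->
  exists2 g : V -> (scalars R k)^o, linear g & forall x, toR (g x) = f x.
Proof.
case: k V f => V f fD fZ.
  by exists f => // a x y; rewrite fD fZ.
pose im : R[i] := Complex 0 1.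
have fN x : f (- x) = - f x.
  by rewrite -[RHS]mulN1r -fZ /= rmorphN1 scaleN1r.
pose g (x : V) : (scalars R ComplexScalars)^o :=
  (Complex (f x) (- f ((im : scalars R ComplexScalars) *: x)) : R[i]).
exists g => // -[u v] x y.
have decomp : (Complex u v : scalars R ComplexScalars) =
    ofR u + ofR v * (im : scalars R ComplexScalars).
  by apply/eqP; rewrite eq_complex /= !(mulr0, mulr1, mul0r, addr0, add0r, subr0) !eqxx.
have imim : (im : scalars R ComplexScalars) * im = -1.
  by apply/eqP; rewrite eq_complex /= !(mulr0, mulr1, mul0r, addr0, add0r, sub0r) oppr0 !eqxx.
have fE z : f ((Complex u v : scalars R ComplexScalars) *: z) =
    u * f z + v * f ((im : scalars R ComplexScalars) *: z).
  by rewrite decomp scalerDl fD -scalerA !fZ.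
have fimE : f ((im : scalars R ComplexScalars) *:
      ((Complex u v : scalars R ComplexScalars) *: x)) =
    u * f ((im : scalars R ComplexScalars) *: x) - v * f x.
  by rewrite scalerA mulrC -scalerA fE scalerA imim scaleN1r fN mulrN.
apply/eqP; rewrite eq_complex; apply/andP; split; apply/eqP.
  by rewrite /= fD fE mulrN opprK.
by rewrite /= scalerDr fD fimE opprD mulrN opprB [in RHS]addrC; ring.
Qed.

Section dual_facts.
Context (R : realType) (k : scalar_kind).
Local Notation K := (scalars R k).

Lemma ofR_inj : injective (@ofR R k).
Proof. exact: can_inj (@ofRK R k). Qed.

Lemma rnorm_ofR (t : R) : 0 <= t -> rnorm (ofR t : K) = t.
Proof.
move=> t0; apply: ofR_inj; rewrite rnormK ger0_norm//.
by rewrite -(@ofR0 R k) ler_ofR.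
Qed.

Lemma rnormM (a b : K) : rnorm (a * b) = rnorm a * rnorm b.
Proof. by apply: ofR_inj; rewrite ofRM !rnormK normrM. Qed.

Lemma rnorm1 : rnorm (1 : K) = 1.
Proof. by rewrite -(ofR1 R k) rnorm_ofR. Qed.

Lemma rnorm_sum (V : normedZmodType K) (I : Type) (r : seq I) (P : pred I)
    (F : I -> V) :
  rnorm (\sum_(i <- r | P i) F i) <= \sum_(i <- r | P i) rnorm (F i).
Proof.
elim/big_rec2: _ => [|i b a _ ab]; first by rewrite rnorm0.
by rewrite (le_trans (rnormD _ _))// lerD2l.
Qed.

Lemma toR_le_rnorm (z : K) : toR z <= rnorm z.
Proof.
rewrite -(ler_ofR k) rnormK; case: k z => z; first exact: ler_norm.
by rewrite /= (le_trans _ (normc_ge_Re z))// lecR ler_norm.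
Qed.

Lemma rotate_to_norm (z : K) : exists2 c : K, rnorm c = 1 & c * z = ofR (rnorm z).
Proof.
have [->|z0] := eqVneq z 0.
  by exists 1; rewrite ?rnorm1// mulr0 rnorm0 ofR0.
exists (`|z| / z); last by rewrite divfK// rnormK.
apply: ofR_inj; rewrite rnormK normrM normr_id normfV divff ?normr_eq0//.
by rewrite ofR1.
Qed.

Section dual_of.
Context (E : normedModType K).

(** The way to enter the type [dual E] without a continuity proof. *)
Lemma dual_of_bounded_linear (g : E -> K^o) (C : R) : linear g ->
  (forall x, rnorm x <= 1 -> rnorm (g x) <= C) ->
  exists2 f : dual E, rnorm f <= C & forall x, f x = g x.
Proof.
move=> lg gC.
pose ga := GRing.isLinear.Build K E K^o _ g lg.
pose gl : {linear E -> K^o} := HB.pack g ga.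
have cg : continuous g.
  apply: (@bounded_linear_continuous K E K^o gl).
  apply/ex_bound; exists (ofR C); apply/nbhs_norm0P; exists 1 => //= x /= x1.
  rewrite -rnormK ler_ofR; apply: gC.
  by rewrite -(ler_ofR k) rnormK ofR1 ltW.
have Pg : g \in @continuous_functional R k E by apply/asboolP.
exists (Dual Pg) => //; rewrite dual_rnormE.
exact: dual_norm_lub.
Qed.

Lemma rnorm_dual_le (f : dual E) (C : R) :
  (forall x, rnorm x <= 1 -> rnorm (f x) <= C) -> rnorm f <= C.
Proof. by rewrite dual_rnormE; exact: dual_norm_lub. Qed.

(** A linear functional below the norm pushed along [x0] is at most
    [- rnorm x0] at [- x0], hence norming for [x0]; its modulus is below the
    norm because a rotation of the argument makes its value real. *)
Lemma norming_functional (x0 : E) :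
  exists2 f : dual E, rnorm f <= 1 & rnorm x0 <= rnorm (f x0).
Proof.
have sN : @sublinear R k E (fun x => rnorm x).
  split=> [x y|t x t0]; first exact: rnormD.
  by rewrite rnormZ rnorm_ofR// ltW.
have [f [f_le fD fZ]] := sublinear_ge_linear (sublinear_push_along x0 sN).
have [g lg gf] := linear_real_part fD fZ.
have [h h1 hg] : exists2 h : dual E, rnorm h <= 1 & forall x, h x = g x.
  apply: dual_of_bounded_linear => // x x1.
  have [c c1 cg] := rotate_to_norm (g x).
  have -> : rnorm (g x) = f (c *: x).
    have g0 : g 0 = 0 by have := lg (-1) 0 0; rewrite scaler0 addr0 scaleN1r addNr.
    by rewrite -gf -[c *: x]addr0 lg g0 addr0 [_ *: _]cg ofRK.
  rewrite (le_trans (f_le _))// (le_trans (push_along_le _ sN _))//.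
  by rewrite rnormZ c1 mul1r.
exists h => //; rewrite hg; apply: le_trans (toR_le_rnorm _); rewrite gf.
have fN : f (- x0) = - f x0.
  by apply/eqP; rewrite -addr_eq0 -fD addNr -(scale0r 0) -ofR0 fZ mul0r.
by rewrite -lerN2 -fN (le_trans (f_le _))// push_along_opp.
Qed.

End dual_of.
End dual_facts.

(** * Weak norms and Cohen norms through finite sums *)

Section weak_and_cohen_norms.
Context (R : realType).

Lemma nneseries_le_fin (u : nat -> R) (c : R) : (forall j, 0 <= u j) ->
  (\sum_(0 <= j <oo) (u j)%:E <= c%:E)%E <-> forall N, \sum_(j < N) u j <= c.
Proof.
move=> u0; have u0' j : (0 <= j)%N -> true -> (0 <= (u j)%:E)%E by rewrite lee_fin.
split=> [uc N|uc].
  rewrite -lee_fin -sumEFin -(big_mkord xpredT (fun j => (u j)%:E)).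
  by apply: le_trans uc; exact: nneseries_lim_ge.
apply: lime_le; first exact: is_cvg_nneseries.
by apply: nearW => N; rewrite big_mkord sumEFin lee_fin.
Qed.

Lemma Lnorm_counting_leP (r c : R) (u : nat -> R) :
  0 < r -> 0 <= c -> (forall j, 0 <= u j) ->
  (Lnorm counting r%:E (fun j => (u j)%:E) <= c%:E)%E <->
  forall N, \sum_(j < N) u j `^ r <= c `^ r.
Proof.
move=> r0 c0 u0; rewrite Lnorm_counting//.
have -> : (\sum_(0 <= k <oo) (`| (u k)%:E | `^ r) =
    \sum_(0 <= k <oo) (u k `^ r)%:E)%E.
  by apply: eq_eseriesr => j _; rewrite abse_EFin ger0_norm// poweR_EFin.
apply: (iff_trans _ (nneseries_le_fin (c `^ r) (fun j => powR_ge0 (u j) r))).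
set S := (\sum_(0 <= k <oo) (u k `^ r)%:E)%E.
have S0 : (0 <= S)%E by apply: nneseries_ge0 => j _ _; rewrite lee_fin powR_ge0.
have rN0 : r != 0 by rewrite gt_eqF.
have mono (t : R) (a b : \bar R) : 0 <= t -> (0 <= a)%E -> (a <= b)%E ->
    (a `^ t <= b `^ t)%E.
  move=> t0 a0 ab; apply: gt0_ler_poweR => //.
    by rewrite in_itv/= a0 leey.
  by rewrite in_itv/= (le_trans a0 ab) leey.
split=> [Sc|Sc].
  have := mono r _ _ (ltW r0) (poweR_ge0 _ _) Sc.
  by rewrite -poweRrM mulVf// poweRe1// poweR_EFin.
have := mono r^-1 _ _ _ S0 Sc; rewrite invr_ge0 => /(_ (ltW r0)).
by rewrite poweR_EFin -powRrM mulfV// powRr1.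
Qed.

Lemma hoelder_conjugate_cases (p : R) : 1 <= p ->
  p = 1 /\ hoelder_conjugate p%:E = +oo%E \/
  exists2 r : R, 0 < r /\ r^-1 = 1 - p^-1 & hoelder_conjugate p%:E = r%:E.
Proof.
rewrite le_eqVlt => /predU1P[<-|p1]; [left|right].
  by rewrite hoelder_conjugate1.
have p0 : 0 < p by exact: lt_trans p1.
exists (p / (p - 1)).
  split; first by rewrite divr_gt0// subr_gt0.
  by rewrite invf_div mulrBl divff ?gt_eqF// mul1r.
rewrite /hoelder_conjugate/= eqe gt_eqF//.
by rewrite -EFinD inver subr_eq0 gt_eqF// -EFinM.
Qed.

(** The unit ball of l_1, restricted to nonnegative sequences. The unit ball of
    l_q is described through it by taking powers of exponent [1 / q]; this form
    remains meaningful for the exponent 0, which stands for l_infinity. *)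
Definition l1_ball (a : nat -> R) : Prop :=
  (forall j, 0 <= a j) /\ forall N, \sum_(j < N) a j <= 1.

Context (k : scalar_kind).
Local Notation K := (scalars R k).

Lemma dual_sumE (E : normedModType K) (N : nat) (f : nat -> dual E) (x : E) :
  (\sum_(j < N) f j) x = \sum_(j < N) f j x.
Proof.
elim: N => [|N IH]; first by rewrite !big_ord0.
by rewrite !big_ord_recr/= -IH.
Qed.

Lemma rnorm_dual_unit_ball (E : normedModType K) (f : dual E) (x : E) :
  rnorm x <= 1 -> rnorm (f x) <= rnorm f.
Proof. by move=> x1; rewrite dual_rnormE dual_norm_ub. Qed.

(** Testing against the functionals of the bidual that are evaluations. *)
Lemma weak_norm_le1_eval (p : R) (E : normedModType K) (psi : nat -> dual E)
    (y : E) : 1 <= p -> (weak_norm (hoelder_conjugate p%:E) psi <= 1)%E ->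
  rnorm y <= 1 ->
  exists2 b, l1_ball b & forall j, rnorm (psi j y) <= b j `^ (1 - p^-1).
Proof.
move=> p1; have [[-> ->]/=|[r [r0 rE] ->]/=] := hoelder_conjugate_cases p1.
  move=> psi1 y1; exists (fun=> 0).
    by split=> // N; rewrite big1 ?ler01.
  move=> j; rewrite invr1 subrr powRr0.
  rewrite (le_trans (rnorm_dual_unit_ball _ y1))//.
  rewrite -lee_fin; apply: le_trans psi1; apply: ereal_sup_ubound.
  by exists j.
move=> psi1 y1.
have lev : linear (fun f : dual E => f y : K^o) by [].
have [ev ev1 evE] : exists2 ev : dual (dual E), rnorm ev <= 1 &
    forall f : dual E, ev f = f y.
  apply: dual_of_bounded_linear => // f f1.
  by rewrite (le_trans (rnorm_dual_unit_ball _ y1)).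
have : (Lnorm counting r%:E (fun j => (rnorm (psi j y))%:E) <= 1%:E)%E.
  apply: le_trans psi1; apply: ereal_sup_ubound; exists ev => //.
  by congr Lnorm; apply/funext => j; rewrite evE.
move/Lnorm_counting_leP => /(_ r0 ler01 (fun=> rnorm_ge0 _)).
rewrite powR1 => psi_le1; exists (fun j => rnorm (psi j y) `^ r).
  by split=> // j; exact: powR_ge0.
by move=> j; rewrite -rE -powRrM mulfV ?gt_eqF// powRr1// rnorm_ge0.
Qed.

(** For sequences in a dual, weak summability only needs to be tested on the
    space itself: by duality of the finite l_q spaces, the strong q-norm of
    [G (phi j)] is attained on a single combination [theta] of the [phi j], and
    the norm of [theta] is a supremum over vectors. *)
Lemma weak_norm_dual_le1 (q : R) (E : normedModType K) (phi : nat -> dual E) :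
  1 <= q ->
  (forall y a N, rnorm y <= 1 -> l1_ball a ->
    \sum_(j < N) a j `^ q^-1 * rnorm (phi j y) <= 1) ->
  (weak_norm (hoelder_conjugate q%:E) phi <= 1)%E.
Proof.
move=> q1 Hphi.
have [[qE ->]/=|[r [r0 rE] ->]/=] := hoelder_conjugate_cases q1.
  apply: ge_ereal_sup => _ [j _ <-]; rewrite lee_fin.
  apply: rnorm_dual_le => y y1.
  pose a i : R := (i == j)%:R.
  have a_ball : l1_ball a.
    split=> [i|N]; first by rewrite ler0n.
    have [jN|Nj] := ltnP j N.
      rewrite (bigD1 (Ordinal jN))//= /a eqxx big1 ?addr0// => i.
      by rewrite -val_eqE/= => /negbTE ->.
    rewrite big1 ?ler01// => i _; rewrite /a.
    by rewrite (ltn_eqF (leq_trans (ltn_ord i) Nj)).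
  have := Hphi y a j.+1 y1 a_ball; apply: le_trans.
  rewrite big_ord_recr/= {2}/a eqxx powR1 mul1r lerDr.
  by apply: sumr_ge0 => i _; rewrite mulr_ge0 ?powR_ge0 ?rnorm_ge0.
apply: ge_ereal_sup => _ [G /= G1 <-].
apply/Lnorm_counting_leP => // [j|M]; first exact: rnorm_ge0.
rewrite powR1; set g := fun j => rnorm (G (phi j)).
rewrite -[leLHS]/(\sum_(j < M) g j `^ r); set s := \sum_(j < M) _.
have s_ge0 : 0 <= s by apply: sumr_ge0 => j _; exact: powR_ge0.
have [->|s_neq0] := eqVneq s 0; first exact: ler01.
have s0 : 0 < s by rewrite lt_def s_neq0.
(* The weight for which Hoelder's inequality is an equality. *)
pose a j : R := if (j < M)%N then g j `^ r / s else 0.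
have a_ball : l1_ball a.
  split=> [j|N]; first by rewrite /a; case: ifP => // _; rewrite divr_ge0// powR_ge0.
  have aM : \sum_(j < M) a j = 1.
    rewrite (eq_bigr (fun j : 'I_M => g j `^ r / s)); last first.
      by move=> j _; rewrite /a ltn_ord.
    by rewrite -mulr_suml divff.
  have a0 j : 0 <= a j by rewrite /a; case: ifP => // _; rewrite divr_ge0// powR_ge0.
  have [NM|MN] := leqP N M.
    rewrite -aM -!(big_mkord xpredT) [leRHS](big_cat_nat _ (n := N))//= lerDl.
    exact: sumr_ge0.
  rewrite -aM -!(big_mkord xpredT) [leLHS](big_cat_nat _ (n := M))//= ?(ltnW MN)//.
  rewrite gerDl big_nat_cond big1// => j /andP[/andP[Mj _] _].
  by rewrite /a ltnNge Mj.
(* The phases align the numbers [G (phi j)], so that no cancellation occurs. *)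
have /choice[c cP] : forall j, exists c : K,
    rnorm c = 1 /\ c * G (phi j) = ofR (g j).
  by move=> j; have [c c1 cG] := rotate_to_norm (G (phi j)); exists c.
pose b j := a j `^ q^-1.
have b0 j : 0 <= b j by exact: powR_ge0.
pose theta := \sum_(j < M) (ofR (b j) * c j) *: phi j.
have theta1 : rnorm theta <= 1.
  apply: rnorm_dual_le => y y1.
  apply: le_trans (Hphi y a M y1 a_ball).
  rewrite (dual_sumE _ (fun j => (ofR (b j) * c j) *: phi j)).
  apply: (le_trans (rnorm_sum _ _ _)); apply: ler_sum => j _.
  by rewrite rnormZ rnormM (cP j).1 mulr1 rnorm_ofR.
have bg1 : \sum_(j < M) b j * g j <= 1.
  have <- : rnorm (G theta) = \sum_(j < M) b j * g j.
    rewrite /theta linear_sum/= -[RHS](rnorm_ofR k); last first.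
      by apply: sumr_ge0 => j _; rewrite mulr_ge0 ?rnorm_ge0.
    congr rnorm; rewrite (big_morph _ (@ofRD R k) (ofR0 R k)).
    apply: eq_bigr => j _; rewrite linearZ/= ofRM -(cP j).2 mulrA.
    by [].
  by rewrite (le_trans (rnorm_dual_unit_ball _ theta1)).
have qE : q^-1 = 1 - r^-1 by rewrite rE opprB addrC subrK.
have bgE : \sum_(j < M) b j * g j = s `^ r^-1.
  transitivity (\sum_(j < M) g j `^ r * s `^ (- q^-1)).
    apply: eq_bigr => j _; rewrite /b /a ltn_ord.
    rewrite powRM ?powR_ge0 ?invr_ge0// -powRrM.
    rewrite -(powR_inv1 (ltW s0)) -powRrM mulN1r mulrAC; congr (_ * _).
    rewrite mulrC qE mulrBr mulr1 mulfV ?gt_eqF//.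
    by rewrite mulr_powRB1// rnorm_ge0.
  rewrite -mulr_suml -/s -[X in X * _]powRr1// -powRD ?s_neq0 ?implybT//.
  by rewrite qE opprB addrC subrK.
have := bg1; rewrite bgE => s1.
have := ge0_ler_powR (ltW r0) _ _ s1.
rewrite !nnegrE powR_ge0 ler01 => /(_ isT isT).
by rewrite powR1 -powRrM mulVf ?gt_eqF// powRr1.
Qed.

Lemma cohen_norm_leP (p C : R) (E : normedModType K) (x : nat -> E) : 0 <= C ->
  (cohen_norm p x <= C%:E)%E <->
  forall phi : nat -> dual E,
    (weak_norm (hoelder_conjugate p%:E) phi <= 1)%E ->
    forall N, \sum_(j < N) rnorm (phi j (x j)) <= C.
Proof.
move=> C0.
have L1 (phi : nat -> dual E) :
    (Lnorm counting 1%:E (fun j => (rnorm (phi j (x j)))%:E) <= C%:E)%E <->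
    forall N, \sum_(j < N) rnorm (phi j (x j)) <= C.
  rewrite Lnorm_counting_leP ?ltr01//; last by move=> j; exact: rnorm_ge0.
  have sumE N : \sum_(j < N) rnorm (phi j (x j)) `^ 1 =
      \sum_(j < N) rnorm (phi j (x j)).
    by apply: eq_bigr => j _; rewrite powRr1// rnorm_ge0.
  by rewrite powRr1//; split=> H N; have := H N; rewrite sumE.
split=> [xC phi phi1|H].
  apply/L1; apply: le_trans xC; apply: ereal_sup_ubound; by exists phi.
by apply: ge_ereal_sup => _ [phi /= phi1 <-]; apply/L1; exact: H.
Qed.

(** The interplay used at each step: a family of functionals that is uniformly
    summable against the unit balls of [E] and of l_q stays summable when it is
    tested along a Cohen strongly q-summable sequence. *)
Lemma cohen_norm_test (q B c : R) (E : normedModType K) (x : nat -> E)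
    (phi : nat -> dual E) : 1 <= q -> 0 <= B -> 0 < c ->
  (cohen_norm q x <= B%:E)%E ->
  (forall y a N, rnorm y <= 1 -> l1_ball a ->
    \sum_(j < N) a j `^ q^-1 * rnorm (phi j y) <= c) ->
  forall N, \sum_(j < N) rnorm (phi j (x j)) <= c * B.
Proof.
move=> q1 B0 c0 /(cohen_norm_leP _ _ B0) xB phic N.
have phicE j (y : E) : rnorm ((ofR c^-1 *: phi j) y) = c^-1 * rnorm (phi j y).
  by rewrite [LHS]rnormZ rnorm_ofR// invr_ge0 ltW.
have := xB (fun j => ofR c^-1 *: phi j) _ N.
under eq_bigr do rewrite phicE.
rewrite -mulr_sumr ler_pdivrMl//; apply; apply: weak_norm_dual_le1 => // y a M y1 a1.
under eq_bigr do rewrite phicE mulrCA.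
by rewrite -mulr_sumr ler_pdivrMl// mulr1; exact: phic.
Qed.

End weak_and_cohen_norms.

(** * Continuous multilinear operators on Cohen summable sequences *)

Section multilinear_operators.
Context (R : realType) (k : scalar_kind) (n : nat).
Local Notation K := (scalars R k).
Context (E : 'I_n -> completeNormedModType K) (F : completeNormedModType K).

Lemma multilinear_dfwithZ (A : (forall i, E i) -> F) (z : forall i, E i)
    (i : 'I_n) (t : K) : multilinear A ->
  A (dfwith z i (t *: z i)) = t *: A z.
Proof.
move=> mA; have lA := mA i z.
have zE : dfwith z i (z i) = z by apply: functional_extensionality_dep => j; case: dfwithP.
have A0 : A (dfwith z i 0) = 0.
  by have := lA (-1) 0 0; rewrite scaler0 addr0 scaleN1r addNr.
by have := lA t (z i) 0; rewrite addr0 A0 addr0 zE.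
Qed.

Lemma multilinear_scale (A : (forall i, E i) -> F) (z : forall i, E i) (t : K) :
  multilinear A -> A (fun i => t *: z i) = t ^+ n *: A z.
Proof.
move=> mA.
pose zt m : forall i, E i := fun i => if (i < m)%N then t *: z i else z i.
have step m : (m <= n)%N -> A (zt m) = t ^+ m *: A z.
  elim: m => [_|m IH mn].
    by rewrite scale1r; congr A; apply: functional_extensionality_dep.
  rewrite exprS -scalerA -IH ?(ltnW mn)// -(multilinear_dfwithZ _ (Ordinal mn))//.
  congr A; apply: functional_extensionality_dep => i.
  case: dfwithP => [|j jm]; first by rewrite /zt /= ltnn ltnSn.
  rewrite /zt ltnS leq_eqVlt; case: eqP => // ji.
  by case/eqP: jm; apply: val_inj.
rewrite -step//; congr A; apply: functional_extensionality_dep => i.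
by rewrite /zt ltn_ord.
Qed.

(** The polydiscs of positive radius form a basis of neighborhoods of 0 in a
    finite product, so some polydisc is mapped into a ball; homogeneity
    then transfers the bound to the unit polydisc. *)
Lemma continuous_multilinear_bounded (A : (forall i, E i) -> F) :
  continuous_multilinear A ->
  exists2 M : R, 0 < M & forall x, (forall i, rnorm (x i) <= 1) -> rnorm (A x) <= M.
Proof.
move=> [mA cA].
pose polydisc (t : R) : set (prod_topology E) := [set x | forall i, rnorm (x i) <= t].
pose D := filter_from [set t : R | 0 < t] polydisc.
have DF : Filter D.
  apply: filter_from_filter; first by exists 1 => /=.
  move=> s t /= s0 t0; exists (Num.min s t); first by rewrite /= lt_min s0.
  by move=> x xst; split=> i; have := xst i; rewrite le_min => /andP[].
pose z : prod_topology E := fun i => 0.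
have Dz : D --> z.
  apply/cvg_sup => i U /=.
  rewrite (@nbhsE (initial_topology (fun f : forall i, E i => f i))).
  move=> [_ [[V oV <-] Vz] VU].
  have /nbhs_norm0P[e /= e0 eV] : nbhs (0 : E i) V by exact: open_nbhs_nbhs.
  have eE : ofR (toR e) = e by rewrite -(gtr0_norm e0) toRK.
  have e0' : 0 < toR e.
    rewrite lt_neqAle -(ler_ofR k) eE ofR0 ltW// andbT.
    by apply: contraTneq e0 => te; rewrite -eE -te ofR0 ltxx.
  exists (toR e / 2); first by rewrite /= divr_gt0.
  move=> x xe; apply: VU; apply: eV => /=.
  rewrite -rnormK -eE lt_neqAle ler_ofR (inj_eq (@ofR_inj R k)).
  by rewrite -lt_neqAle (le_lt_trans (xe i))// ltr_pdivrMr// ltr_pMr// ltr1n.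
have : nbhs z (A @^-1` [set y | rnorm (y - A z) <= 1]).
  apply: (cA z); apply/nbhs_normP; exists 1 => //= y /= y1.
  rewrite -(ler_ofR k) rnormK ofR1 distrC ltW//.
move/Dz => [t /= t0 tA].
exists (t^-1 ^+ n * (rnorm (A z) + 1)).
  by rewrite mulr_gt0 ?exprn_gt0 ?invr_gt0// ltr_wpDl// rnorm_ge0.
move=> x x1.
have -> : x = (fun i => ofR t^-1 *: (ofR t *: x i)).
  apply: functional_extensionality_dep => i.
  by rewrite scalerA -ofRM mulVf ?gt_eqF// ofR1 scale1r.
rewrite multilinear_scale// rnormZ.
have -> : rnorm ((ofR t^-1 : K) ^+ n) = t^-1 ^+ n.
  have -> : (ofR t^-1 : K) ^+ n = ofR (t^-1 ^+ n).
    by elim: (n) => [|m IH]; rewrite ?expr0 ?ofR1// !exprS IH ofRM.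
  by rewrite rnorm_ofR// exprn_ge0// invr_ge0 ltW.
apply: ler_wpM2l; first by rewrite exprn_ge0// invr_ge0 ltW.
rewrite -(subrK (A z) (A _)) (le_trans (rnormD _ _))// addrC lerD2l.
apply: tA => i; rewrite rnormZ rnorm_ofR ?(ltW t0)//.
by apply: ler_piMr; [exact: ltW|exact: x1].
Qed.

Lemma dual_comp_multilinear (A : (forall i, E i) -> F) (psi : dual F)
    (z : forall i, E i) (i : 'I_n) : continuous_multilinear A ->
  exists f : dual (E i), forall v, f v = psi (A (dfwith z i v)).
Proof.
move=> [mA cA]; pose g (v : E i) : K^o := psi (A (dfwith z i v)).
suff Pg : g \in @continuous_functional R k (E i) by exists (Dual Pg).
apply/asboolP; split=> [a u v|v].
  by rewrite /g mA linearP.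
apply: (@continuous_comp _ F K^o (fun v => A (dfwith z i v)) psi); last exact: dual_continuous.
apply: (@continuous_comp _ (prod_topology E) F (dfwith z i) A); last exact: cA.
exact: (@dfwith_continuous _ E z i).
Qed.

Section replacement.
Context (A : (forall i, E i) -> F) (x : forall i, nat -> E i) (p M : R)
  (q B : 'I_n -> R) (psi : nat -> dual F).
Hypotheses (cA : continuous_multilinear A) (p1 : 1 <= p) (q1 : forall i, 1 <= q i)
  (pq : p^-1 <= \sum_i (q i)^-1) (M0 : 0 < M) (B0 : forall i, 0 < B i)
  (AM : forall y, (forall i, rnorm (y i) <= 1) -> rnorm (A y) <= M)
  (xB : forall i, (cohen_norm (q i) (x i) <= (B i)%:E)%E)
  (psi1 : (weak_norm (hoelder_conjugate p%:E) psi <= 1)%E).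

Definition splice (m : nat) (y : forall i, E i) (j : nat) : forall i, E i :=
  fun i => if (i < m)%N then x i j else y i.

(** Vectors of the unit balls are replaced one coordinate at a time by the
    given sequences. As long as coordinate [i] holds a fixed vector, it carries
    a weight from the unit ball of l_(q i). With no coordinate replaced this is
    the Hoelder inequality, which needs the hypothesis on the exponents; the
    replacement of coordinate [m] trades its weight for [x m] by
    [cohen_norm_test]. *)
Lemma splice_sum_le (m : nat) : (m <= n)%N ->
  forall (y : forall i, E i) (a : 'I_n -> nat -> R) (N : nat),
  (forall i, rnorm (y i) <= 1) -> (forall i, l1_ball (a i)) ->
  \sum_(j < N) (\prod_(i < n | (m <= i)%N) a i j `^ (q i)^-1) *
    rnorm (psi j (A (splice m y j))) <= M * \prod_(i < n | (i < m)%N) B i.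
Proof.
elim: m => [_|m IH mn] y a N y1 a1.
  rewrite [X in _ <= _ * X]big_pred0// mulr1.
  have spliceE j : splice 0 y j = y by apply: functional_extensionality_dep.
  have My1 : rnorm (ofR M^-1 *: A y) <= 1.
    by rewrite rnormZ rnorm_ofR ?invr_ge0 ?(ltW M0)// ler_pdivrMl// mulr1 AM.
  have [b [b0 b1] psib] := weak_norm_le1_eval p1 psi1 My1.
  (* Index 0 holds the conjugate exponent, which belongs to [psi]. *)
  pose w (i : 'I_n.+1) : R := if unlift ord0 i is Some i' then (q i')^-1 else 1 - p^-1.
  pose c (i : 'I_n.+1) : nat -> R := if unlift ord0 i is Some i' then a i' else b.
  have Vp : p^-1 <= 1 by rewrite invf_le1// (lt_le_trans ltr01).
  have q0 i : 0 <= (q i)^-1 by rewrite invr_ge0 (le_trans ler01).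
  have : \sum_(j < N) \prod_i c i j `^ w i <= 1.
    apply: hoelder_prod_le1 => [i||i j|i]; rewrite /w /c.
    - by case: unliftP => // _; rewrite subr_ge0.
    - rewrite big_ord_recl unlift_none; under eq_bigr do rewrite liftK.
        by rewrite -addrA lerDl addrC subr_ge0.
    - by case: unliftP => // i' _; exact: (a1 i').1.
    - by case: unliftP => // i' _; exact: (a1 i').2.
  move=> /(ler_wpM2l (ltW M0)); rewrite mulr1; apply: le_trans.
  rewrite mulr_sumr; apply: ler_sum => j _; rewrite spliceE.
  rewrite big_ord_recl /w /c unlift_none.
  under [X in _ <= M * (_ * X)]eq_bigr do rewrite liftK.
  rewrite mulrA mulrC; apply: ler_wpM2r.
    by apply: prodr_ge0 => i _; exact: powR_ge0.
  rewrite -ler_pdivrMl//; apply: le_trans (psib j).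
  by rewrite linearZ/= rnormZ rnorm_ofR// invr_ge0 ltW.
pose i0 := Ordinal mn.
have [phi phiE] : exists phi : nat -> dual (E i0), forall j v,
    phi j v = psi j (A (dfwith (splice m y j) i0 v)).
  have /choice[phi phiE] : forall j, exists f : dual (E i0), forall v,
      f v = psi j (A (dfwith (splice m y j) i0 v)).
    by move=> j; exact: dual_comp_multilinear.
  by exists phi.
pose c j : R := \prod_(i < n | (m < i)%N) a i j `^ (q i)^-1.
have c0 j : 0 <= c j by apply: prodr_ge0 => i _; exact: powR_ge0.
have cphiE j v : rnorm ((ofR (c j) *: phi j) v) =
    c j * rnorm (psi j (A (dfwith (splice m y j) i0 v))).
  by rewrite -phiE [LHS]rnormZ rnorm_ofR.
have splitB : \prod_(i < n | (i < m.+1)%N) B i = (\prod_(i < n | (i < m)%N) B i) * B i0.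
  rewrite (bigD1 i0) ?ltnSn//= mulrC; congr (_ * _); apply: eq_bigl => i.
  by rewrite ltnS -val_eqE/= [RHS]ltn_neqAle andbC.
have cm0 : 0 < M * \prod_(i < n | (i < m)%N) B i.
  by rewrite mulr_gt0// prodr_gt0.
rewrite splitB mulrA.
have test : forall v b N', rnorm v <= 1 -> l1_ball b ->
    \sum_(j < N') b j `^ (q i0)^-1 * rnorm ((ofR (c j) *: phi j) v) <=
    M * \prod_(i < n | (i < m)%N) B i.
  move=> v b N' v1 b1.
  pose y' := dfwith y i0 v; pose a' i := if i == i0 then b else a i.
  have y'1 i : rnorm (y' i) <= 1 by rewrite /y'; case: dfwithP.
  have a'1 i : l1_ball (a' i) by rewrite /a'; case: ifP.
  have := IH (ltnW mn) y' a' N' y'1 a'1.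
  apply: le_trans; apply: ler_sum => j _; rewrite cphiE mulrA.
  rewrite (bigD1 i0)//= {1}/a' eqxx.
  rewrite (_ : \prod_(i < n | (m <= i)%N && (i != i0)) _ = c j); last first.
    apply: eq_big => [i|i /andP[_ /negbTE ii0]]; last by rewrite /a' ii0.
    by rewrite [RHS]ltn_neqAle -val_eqE/= andbC eq_sym.
  rewrite (_ : splice m y' j = dfwith (splice m y j) i0 v)//.
  apply: functional_extensionality_dep => i; rewrite /splice /y'.
  case: (dfwithP _ _ i) => [|i' ii']; first by rewrite /= ltnn dfwithin.
  by rewrite dfwithout.
have := cohen_norm_test (phi := fun j => ofR (c j) *: phi j) (q1 i0) (ltW (B0 i0)) cm0 (xB i0) test N.
apply: le_trans; apply: ler_sum => j _; rewrite cphiE.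
rewrite (_ : dfwith _ _ _ = splice m.+1 y j)//.
apply: functional_extensionality_dep => i; rewrite /splice.
case: (dfwithP _ _ i) => [|i' ii']; first by rewrite /= ltnSn.
rewrite ltnS [(i' <= m)%N]leq_eqVlt; case: eqP => // im.
by case/eqP: ii'; apply: val_inj.
Qed.

End replacement.

Lemma cohen_norm_induced_le (A : (forall i, E i) -> F) (x : forall i, nat -> E i)
    (p M : R) (q B : 'I_n -> R) :
  continuous_multilinear A -> 1 <= p -> (forall i, 1 <= q i) ->
  p^-1 <= \sum_i (q i)^-1 -> 0 < M -> (forall i, 0 < B i) ->
  (forall y, (forall i, rnorm (y i) <= 1) -> rnorm (A y) <= M) ->
  (forall i, (cohen_norm (q i) (x i) <= (B i)%:E)%E) ->
  (cohen_norm p (Defs.induced A x) <= (M * \prod_i B i)%:E)%E.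
Proof.
move=> cA p1 q1 pq M0 B0 AM xB.
apply/cohen_norm_leP; first by rewrite mulr_ge0 ?ltW// prodr_gt0.
move=> psi psi1 N.
have y1 : forall i, rnorm (0 : E i) <= 1 by move=> i; rewrite rnorm0.
have a1 (i : 'I_n) : l1_ball (fun=> 0 : R).
  by split=> // N'; rewrite big1// ler01.
have := splice_sum_le cA p1 q1 pq M0 B0 AM xB psi1 (leqnn n) N y1 a1.
have -> : \prod_(i < n | (i < n)%N) B i = \prod_i B i.
  by apply: eq_bigl => i; rewrite ltn_ord.
apply: le_trans; apply: ler_sum => j _.
rewrite big_pred0 ?mul1r; last by move=> i; rewrite leqNgt ltn_ord.
rewrite /Defs.induced (_ : splice x n (fun=> 0) j = fun i => x i j)//.
by apply: functional_extensionality_dep => i; rewrite /splice ltn_ord.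
Qed.

End multilinear_operators.

(** * Isometric equality of the classes of operators *)

Section main.
Context (R : realType) (k : scalar_kind).
Local Notation K := (scalars R k).

Lemma cohen_norm_ge0 (p : R) (E : normedModType K) (x : nat -> E) :
  1 <= p -> (0 <= cohen_norm p x)%E.
Proof.
move=> p1; pose phi : nat -> dual E := fun=> 0.
apply: (@le_trans _ _ (Lnorm counting 1%:E (fun j => (rnorm (phi j (x j)))%:E))).
  exact: Lnorm_ge0.
apply: ereal_sup_ubound; exists phi => //; apply: weak_norm_dual_le1 => // y a N _ _.
rewrite big1 ?ler01// => j _.
by rewrite (_ : phi j y = 0)// rnorm0 mulr0.
Qed.

Lemma fine_cohen_norm_le (p C : R) (E : normedModType K) (x : nat -> E) :
  1 <= p -> (cohen_norm p x <= C%:E)%E -> fine (cohen_norm p x) <= C.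
Proof.
by move=> /(cohen_norm_ge0 x); case: (cohen_norm p x).
Qed.

(** A functional norming [x 0] is tested against the first term only. *)
Lemma rnorm_le_cohen_norm (p : R) (E : normedModType K) (x : nat -> E) :
  1 <= p -> (cohen_norm p x < +oo)%E -> rnorm (x 0%N) <= fine (cohen_norm p x).
Proof.
move=> p1 xfin; set C := fine _.
have xE : cohen_norm p x = C%:E.
  by rewrite fineK// ge0_fin_numE// cohen_norm_ge0.
have C0 : 0 <= C by rewrite -lee_fin -xE cohen_norm_ge0.
have [f f1 fx] := norming_functional (x 0%N).
pose phi j : dual E := if j is 0%N then f else 0.
have xC : (cohen_norm p x <= C%:E)%E by rewrite xE.
have := (cohen_norm_leP p x C0).1 xC phi.
suff phi1 : (weak_norm (hoelder_conjugate p%:E) phi <= 1)%E.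
  by move=> /(_ phi1 1%N); rewrite big_ord1; exact: le_trans.
apply: weak_norm_dual_le1 => // y a [|N] y1 [a0 a1]; first by rewrite big_ord0 ler01.
rewrite big_ord_recl big1 ?addr0 => [|j _]; last first.
  by rewrite (_ : phi (lift ord0 j) y = 0)// rnorm0 mulr0.
have a01 : a 0%N <= 1 by have := a1 1%N; rewrite big_ord1.
rewrite mulr_ile1 ?powR_ge0 ?rnorm_ge0//.
  by apply: powR_le1 => //; rewrite invr_ge0 (le_trans ler01).
by rewrite (le_trans (rnorm_dual_unit_ball _ y1)).
Qed.

Lemma cohen_norm_single (q : R) (E : normedModType K) (x : E) : 1 <= q ->
  rnorm x <= 1 -> (cohen_norm q (fun j => if j is 0%N then x else 0%R) <= 1%:E)%E.
Proof.
move=> q1 x1; apply/cohen_norm_leP => // phi phi1 [|N]; first by rewrite big_ord0 ler01.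
rewrite big_ord_recl big1 ?addr0 => [|j _]; last by rewrite /= linear0 rnorm0.
have [b [b0 b1] phib] := weak_norm_le1_eval q1 phi1 x1.
have b01 : b 0%N <= 1 by have := b1 1%N; rewrite big_ord1.
rewrite (le_trans (phib _))//; apply: powR_le1 => //.
by rewrite subr_ge0 invf_le1// (lt_le_trans ltr01).
Qed.

Lemma cohen_multilinear (n : nat) (p : R) (q : 'I_n -> R) :
  1 <= p -> (forall i, 1 <= q i) -> p^-1 <= \sum_(i < n) (q i)^-1 ->
  all_multilinear_isometrically (fun i => cohen k (q i)) (cohen k p).
Proof.
move=> p1 q1 pq E F A cA.
have [M M0 AM] := continuous_multilinear_bounded cA.
have fin_induced (x : forall i, nat -> E i) :
    (forall i, (cohen_norm (q i) (x i) < +oo)%E) ->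
    (cohen_norm p (Defs.induced A x) < +oo)%E.
  (* Adding 1 keeps the bounds positive even for null sequences. *)
  move=> xfin; pose B i := fine (cohen_norm (q i) (x i)) + 1.
  have xB i : (cohen_norm (q i) (x i) <= (B i)%:E)%E.
    rewrite EFinD fineK; last by rewrite ge0_fin_numE// cohen_norm_ge0.
    by rewrite leeDl// lee_fin.
  have B0 i : 0 < B i by rewrite ltr_wpDl// fine_ge0// cohen_norm_ge0.
  have := cohen_norm_induced_le cA p1 q1 pq M0 B0 AM xB.
  by move/le_lt_trans; apply; rewrite ltry.
split=> [x xfin|]; first exact: fin_induced.
apply/le_anti/andP; split.
  apply: ge_ereal_sup => _ [x /= xP <-].
  have [nA AE nA0] : exists2 nA : R, multilinear_norm A = nA%:E & 0 <= nA.
    have A_le : (multilinear_norm A <= M%:E)%E.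
      by apply: ge_ereal_sup => _ [y /= y1 <-]; rewrite lee_fin AM.
    have A_ge : (0 <= multilinear_norm A)%E.
      apply: (@le_trans _ _ (rnorm (A (fun=> 0)))%:E); first by rewrite lee_fin rnorm_ge0.
      by apply: ereal_sup_ubound; exists (fun=> 0) => // i; rewrite rnorm0.
    exists (fine (multilinear_norm A)); last exact: fine_ge0.
    by rewrite fineK// ge0_fin_numE// (le_lt_trans A_le)// ltry.
  have AnA y : (forall i, rnorm (y i) <= 1) -> rnorm (A y) <= nA.
    by move=> y1; rewrite -lee_fin -AE; apply: ereal_sup_ubound; exists y.
  (* The slack [e] provides a positive bound also when [A] vanishes. *)
  rewrite AE lee_fin; apply/ler_addgt0Pr => e e0.
  apply: fine_cohen_norm_le => //.
  have -> : nA + e = (nA + e) * \prod_(i < n) 1 by rewrite big1_eq mulr1.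
  apply: cohen_norm_induced_le pq _ _ _ _ => //.
  - by rewrite ltr_wpDl.
  - by move=> y y1; rewrite (le_trans (AnA y y1))// lerDl ltW.
  - move=> i; have [xfin x1] := xP i.
    rewrite -(fineK (x := cohen_norm _ _)) ?lee_fin//.
    by rewrite ge0_fin_numE// cohen_norm_ge0.
(* Conversely, sequences with a single nonzero term recover the norm of [A]. *)
apply: ge_ereal_sup => _ [y /= y1 <-].
pose x i : nat -> E i := fun j => if j is 0%N then y i else 0.
have x1 i : (cohen_norm (q i) (x i) <= 1%:E)%E. by apply: cohen_norm_single => //; exact: y1.
have xfin i : (cohen_norm (q i) (x i) < +oo)%E by exact: le_lt_trans (x1 i) (ltry 1).
apply: (@le_trans _ _ (fine (cohen_norm p (Defs.induced A x)))%:E).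
  by rewrite lee_fin; apply: rnorm_le_cohen_norm => //; exact: fin_induced.
apply: ereal_sup_ubound; exists x => // i; split; first exact: xfin.
exact: fine_cohen_norm_le.
Qed.

End main.

Theorem theorem3p6 (R : realType) (k : scalar_kind) :
  (forall (n : nat) (p : R) (q : 'I_n -> R),
     (0 < n)%N -> 1 <= p -> (forall i, 1 <= q i) ->
     p^-1 <= \sum_(i < n) (q i)^-1 ->
     all_multilinear_isometrically (fun i => cohen k (q i)) (cohen k p)) /\
  (forall p : R, 1 <= p -> multilinearly_stable (cohen k p)).
Proof.
split=> [n p q _|p p1 n n0]; first exact: cohen_multilinear.
apply: cohen_multilinear => //; rewrite sumr_const card_ord.
by rewrite -mulr_natr ler_peMr ?ler1n// invr_ge0 (le_trans ler01).
Qed.
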